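(* Let $n \geq 4$ be an integer. Given two vertices $w_{0}, w_{2n}$ (not necessarily distinct) of the odd graph $O_{n}$ and elements $\lambda_{1}, \lambda_{2} \in \{1, 2, \dots, 2n-1\}$ with $\lambda_{1} \notin [w_{0}]$ and $\lambda_{2} \notin [w_{2n}]$, there exists a $2n$-special walk from $w_{0}$ to $w_{2n}$ such that its first edge is labeled with $\lambda_{1}$ and its last edge is labeled with $\lambda_{2}$.
   Context: The odd graph $O_{n}$ has one vertex for each $(n-1)$-element subset of $\{1, 2, \dots, 2n-1\}$, and two vertices are adjacent if and only if the corresponding subsets are disjoint. For a vertex $v$ of $O_n$, $[v]$ denotes the corresponding subset. Each edge $uv$ is labeled with the unique element of $\{1, \dots, 2n-1\}$ contained in neither $[u]$ nor $[v]$. A walk of length $k$ from $v_0$ to $v_k$ is a sequence of vertices $v_0 v_1 \dots v_k$ with consecutive vertices adjacent (vertices and edges may repeat); its edges are $v_0v_1, v_1v_2, \dots, v_{k-1}v_k$. A special walk is a walk in which every two consecutive edges are distinct. A $k$-special walk is a special walk of length $k$. *)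

(* Defs.v *)
From mathcomp Require Import all_boot.

Set Implicit Arguments.
Unset Strict Implicit.
Unset Printing Implicit Defensive.

(* The ground set {1, ..., 2n-1} is encoded as 'I_(2 * n - 1), that is, with
   its elements renumbered 0, ..., 2n-2. *)
Definition odd_vertex (n : nat) : Type :=
  {A : {set 'I_(2 * n - 1)} | #|A| == n - 1}.

Definition vset (n : nat) (v : odd_vertex n) : {set 'I_(2 * n - 1)} := sval v.

Definition odd_adj (n : nat) : rel (odd_vertex n) :=
  fun u v => [disjoint vset u & vset v].

(* An edge is the unordered pair of its ends.  [edge_labeled e x] says that x
   is the unique element contained in none of the sets of the ends of e. *)
Definition edge_labeled (n : nat) (e : {set odd_vertex n})
    (x : 'I_(2 * n - 1)) : bool :=
  ~: (\bigcup_(v in e) vset v) == [set x].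

Lemma edge_labelP (n : nat) (u v : odd_vertex n) :
  0 < n -> odd_adj u v -> exists! x, edge_labeled [set u; v] x.
Proof.
move=> n_gt0 uv.
have /cards1P[x Ex] : #|~: (vset u :|: vset v)| == 1.
  rewrite cardsCs setCK card_ord cardsU.
  have /eqP-> : vset u :&: vset v == set0 by rewrite setI_eq0.
  rewrite cards0 subn0 /vset (eqP (svalP u)) (eqP (svalP v)).
  by case: n n_gt0 {u v uv} => // n _; rewrite !subn1 mul2n -addnn addnS /= subSnn.
have EU : \bigcup_(w in [set u; v]) vset w = vset u :|: vset v.
  by rewrite bigcup_setU !big_set1.
exists x; split; rewrite /edge_labeled EU Ex // => y /eqP/set1_inj //.
Qed.

(* A walk v_0 v_1 ... v_k is given by v_0 and the sequence p = v_1 ... v_k. *)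
Definition walk_edges (n : nat) (v0 : odd_vertex n) (p : seq (odd_vertex n)) :
    seq {set odd_vertex n} :=
  pairmap (fun u v => [set u; v]) v0 p.

Definition walk (n k : nat) (v0 vk : odd_vertex n) (p : seq (odd_vertex n)) :
    bool :=
  [&& path (@odd_adj n) v0 p, size p == k & last v0 p == vk].

(* [sorted] with respect to [!=]: consecutive edges are distinct. *)
Definition special_walk (n k : nat) (v0 vk : odd_vertex n)
    (p : seq (odd_vertex n)) : bool :=
  walk k v0 vk p && sorted (fun e f => e != f) (walk_edges v0 p).

(* For k > 0 the defaults [set0] are never used. *)
Definition first_edge (n : nat) (v0 : odd_vertex n) (p : seq (odd_vertex n)) :
    {set odd_vertex n} :=
  head set0 (walk_edges v0 p).

Definition last_edge (n : nat) (v0 : odd_vertex n) (p : seq (odd_vertex n)) :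
    {set odd_vertex n} :=
  last set0 (walk_edges v0 p).

(* Main.v *)
Require Import Defs.
From mathcomp Require Import all_boot zify.

(** A special walk can be prescribed by its first vertex and the labels of its
    edges: from the set [A], the edge labeled [x] (where [x \notin A]) leads to
    the complement of [x |: A].  Edges with distinct labels are distinct, so it is
    enough to find a sequence of labels without equal neighbours.  Two steps
    labeled [a] and then [b] replace [A] by [swap a b A], which gains [a \notin A]
    and loses [b \in A]; thus the task is to find [n] swaps such that an element
    just lost is not regained at once.

    The first swap has to gain [l1] and the last one has to lose [l2], but the
    element [b] lost first and the element [a] gained last are free.  After they
    are chosen, [n - 2] swaps have to lead from [A = swap l1 b (vset w0)] to
    [B = swap l2 a (vset w2n)], where the first must not gain [b] and the last
    must not lose [a].  Let [d] be the number of elements of [A] outside [B].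
    Such swaps exist as soon as [1 <= d <= n - 2] ([many_swaps]): one repeatedly
    lowers [d] by a swap, or keeps it equal to [1] by gaining an element outside
    both sets ([closer]); the last swap is then forced ([one_swap]).  Here
    [4 <= n] provides at least two swaps, and a complement of [A] large enough
    for the elements to be gained.

    The choice of [a] and [b] secures both bounds ([label_walk_ends]).  The sets
    [l1 |: vset w0] and [l2 |: vset w2n] have [n] elements each among [2n - 1],
    hence share some [z]; sparing [z] gives [d <= n - 2].  There are at least two
    candidates for [b] other than [z], and one of them makes the two sets
    different, that is, [1 <= d]. *)

(** * Label sequences and swaps *)

Lemma all2_last (S U : Type) (r : S -> U -> bool)
    (e : S) (es : seq S) (x : U) (s : seq U) :
  all2 r (e :: es) (x :: s) -> r (last e es) (last x s).
Proof.
elim: es e x s => [|f es IHes] e x [|y s] //=; rewrite ?andbT ?andbF //.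
by case/andP=> _; apply: IHes.
Qed.

Section LabelWalks.
Variable T : finType.
Implicit Types (A B C : {set T}) (a b f g x y z : T) (s t : seq T).

(** Only the alternation of sets is recorded here; that consecutive labels
    differ is stated separately, as a [path] condition, because it also involves
    the labels that precede and follow the sequence. *)
Fixpoint label_walk A s B : bool :=
  if s is x :: s' then (x \notin A) && label_walk (~: (x |: A)) s' B
  else A == B.

Lemma label_walk_cat A s C t B :
  label_walk A s C -> label_walk C t B -> label_walk A (s ++ t) B.
Proof.
elim: s A => [|x s IHs] A /=; first by move/eqP->.
by case/andP=> -> /IHs.
Qed.

Definition swap a b A : {set T} := a |: (A :\ b).

Lemma label_walk_swap a b A s B : a \notin A -> b \in A ->
  label_walk (swap a b A) s B -> label_walk A [:: a, b & s] B.
Proof.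
move=> aA bA walk_s /=; rewrite aA !inE bA orbT /=.
suff -> : ~: (b |: ~: (a |: A)) = swap a b A by [].
apply/setP=> x; rewrite !inE negb_or negbK.
by case: (x =P a) => [->|]; case: eqVneq aA => //= ->; rewrite bA.
Qed.

Lemma swapK a b A : a \notin A -> b \in A -> swap b a (swap a b A) = A.
Proof.
move=> aA bA; apply/setP=> x; rewrite !inE.
case: (eqVneq x b) => [->|_] /=; first by rewrite bA.
by case: eqVneq => [->|_] //=; rewrite (negPf aA).
Qed.

Lemma card_swap a b A : a \notin A -> b \in A -> #|swap a b A| = #|A|.
Proof. by move=> aA bA; rewrite cardsU1 (cardsD1 b A) bA !inE (negPf aA) andbF. Qed.

Lemma exists_notin A B : #|A| < #|B| -> exists2 x, x \in B & x \notin A.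
Proof.
move=> ltAB; apply/subsetPn; apply: contraTN ltAB => /subset_leq_card.
by rewrite -leqNgt.
Qed.

Lemma eq_card_setD A B : #|A| = #|B| -> #|A :\: B| = #|B :\: A|.
Proof. by move=> eqAB; rewrite !cardsD eqAB setIC. Qed.

Lemma one_swap A B f g : #|A| = #|B| -> #|A :\: B| = 1 ->
    f \notin B :\: A -> g \notin A :\: B ->
  exists s, [/\ size s = 2, label_walk A s B
            & path (fun x y => x != y) f (rcons s g)].
Proof.
move=> eqAB dAB fBA gAB.
have /eqP/cards1P[y BAy] : #|B :\: A| = 1 by rewrite -eq_card_setD.
have /eqP/cards1P[x ABx] := dAB.
have inB z : (z \in B) = (z == y) || (z != x) && (z \in A).
  have := congr1 (fun S : {set T} => z \in S) ABx.
  have := congr1 (fun S : {set T} => z \in S) BAy.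
  by rewrite !inE => <- <-; case: (z \in A); case: (z \in B).
have /setDP[yB yA] : y \in B :\: A by rewrite BAy inE.
have /setDP[xA xB] : x \in A :\: B by rewrite ABx inE.
exists [:: y; x]; split=> //.
  apply: label_walk_swap => //=; apply/eqP/setP=> z; rewrite inB.
  by rewrite !inE.
move: fBA gAB; rewrite BAy ABx !inE /= => -> gx.
by rewrite (eq_sym x g) gx /= andbT; apply: contraNneq yA => ->.
Qed.

(** One swap of the walk from [A] to [B], which lowers the distance
    [#|A :\: B|], except that distance [1] is kept: there [a] is taken outside
    both sets, where the hypothesis on [~: A] leaves at least three elements, one of
    which is neither [f] nor [g].  The last conclusion is what the final swap needs,
    since at distance [1] it has to lose the only element of [swap a b A :\: B];
    for this reason [b] is [g] itself whenever [g] is still to be lost. *)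
Lemma closer A B f g : 4 <= #|~: A| -> #|A| = #|B| -> 0 < #|A :\: B| ->
  exists a b, [/\ a \notin A, b \in A :\: B, a != f,
    0 < #|swap a b A :\: B| <= maxn 1 #|A :\: B|.-1
  & #|swap a b A :\: B| = 1 -> g \notin swap a b A :\: B].
Proof.
move=> cA eqAB dAB.
have [b bAB gb] : exists2 b, b \in A :\: B & g \notin (A :\: B) :\ b.
  case: (boolP (g \in A :\: B)) => gAB; first by exists g; rewrite // !inE eqxx.
  by have /card_gt0P[b] := dAB; exists b; rewrite // in_setD1 negb_and gAB orbT.
have dAB1 : #|(A :\: B) :\ b| = #|A :\: B|.-1 by rewrite (cardsD1 b (A :\: B)) bAB.
have [bA bB] := setDP bAB.
have [dAB_gt1|dAB_le1] := ltnP 1 #|A :\: B|.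
  (* Here [B :\: A] has at least two elements, so one of them is not [f]. *)
  have [a /setDP[aB aA] af] : exists2 a, a \in B :\: A & a \notin [set f].
    by apply: exists_notin; rewrite cards1 -eq_card_setD.
  have dS : swap a b A :\: B = (A :\: B) :\ b.
    apply/setP=> x; rewrite !inE; case: eqVneq => [->|_] /=.
      by rewrite aB andbF.
    by rewrite andbCA.
  exists a, b; rewrite dS dAB1; split=> //; first by rewrite -in_set1.
  lia.
have [a aD afg] : exists2 a, a \in ~: A :\: B & a \notin [set f; g].
  apply: exists_notin; have -> : ~: A :\: B = ~: A :\: (B :\: A).
    by apply/setP=> x; rewrite !inE; case: (x \in A); rewrite ?andbF.
  rewrite cards2 cardsDS; last by apply/subsetP=> x; rewrite !inE => /andP[].
  by rewrite -eq_card_setD //; case: eqVneq; lia.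
move: aD afg; rewrite !inE negb_or => /andP[aB aA] /andP[af ag].
have dS : swap a b A :\: B = [set a].
  have /eqP AB0 : (A :\: B) :\ b == set0 by rewrite -cards_eq0 dAB1; lia.
  apply/setP=> x; move/setP/(_ x): AB0; rewrite !inE.
  case: (eqVneq x a) => [->|_] /=; first by rewrite aB.
  by rewrite andbCA.
exists a, b; rewrite dS cards1 inE (eq_sym g); split=> //; lia.
Qed.

(** The first label must avoid [f] and the last one [g], so that the sequence can
    be extended by [f] and [g].  At least two swaps are needed: with a single one,
    both labels are forced and may be [f] and [g].  Swaps in excess of the
    distance are spent at distance [1]. *)
Lemma many_swaps k A B f g : 4 <= #|~: A| -> #|A| = #|B| ->
    0 < #|A :\: B| <= k.+2 ->
  exists s, [/\ size s = 2 * k.+2, label_walk A s B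
            & path (fun x y => x != y) f (rcons s g)].
Proof.
elim: k A f => [|k IHk] A f cA eqAB /andP[dAB_gt0 dAB_le];
  have [a [b [aA /setDP[bA bB] af dS gS]]] := closer A B f g cA eqAB dAB_gt0;
  have eqS : #|swap a b A| = #|B| by rewrite card_swap.
- have [|||s [ss ws ps]] := one_swap (swap a b A) B b g eqS.
  + by lia.
  + by rewrite !inE negb_and (negPf bB) orbT.
  + by apply: gS; lia.
  exists [:: a, b & s]; split; first by rewrite /= ss.
    exact: label_walk_swap.
  by rewrite /= eq_sym af ps andbT /=; apply: contraNneq aA => ->.
- have [||s [ss ws ps]] := IHk (swap a b A) b _ eqS.
  + by have := cardsC (swap a b A); rewrite card_swap // -(cardsC A) => /addnI ->.
  + by lia.
  exists [:: a, b & s]; split; first by rewrite /= ss; lia.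
    exact: label_walk_swap.
  by rewrite /= eq_sym af ps andbT /=; apply: contraNneq aA => ->.
Qed.

(** The form of the theorem for sets: the first swap loses some [b], the last
    one gains some [a], and [many_swaps] fills the gap. *)
Lemma label_walk_ends m A B x y : 3 <= m -> #|T| = (2 * m).+1 ->
    #|A| = m -> #|B| = m -> x \notin A -> y \notin B ->
  exists s, [/\ size s = 2 * m, label_walk A (x :: rcons s y) B
            & path (fun x y => x != y) x (rcons s y)].
Proof.
move=> m_ge3 cT cA cB xA yB.
(* The two enlarged sets have [m + 1] elements each among [2m + 1]. *)
have [z /setIP[zA zB]] : exists z, z \in (x |: A) :&: (y |: B).
  apply/card_gt0P; have := cardsUI (x |: A) (y |: B).
  have : #|(x |: A) :|: (y |: B)| <= #|T| := max_card _.
  by rewrite !cardsU1 xA yB cA cB cT; lia.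
have [a aB] : exists2 a, a \in B & a \notin [set z].
  by apply: exists_notin; rewrite cards1 cB; lia.
rewrite inE => az.
(* For distinct [b] and [c] the sets [swap x b A] and [swap x c A] differ, so
   one of them is not [swap y a B]. *)
have [b [bA bz neq]] : exists b, [/\ b \in A, b != z & swap x b A != swap y a B].
  have [b bA] : exists2 b, b \in A & b \notin [set z].
    by apply: exists_notin; rewrite cards1 cA; lia.
  rewrite inE => bz.
  have [c cA' /=] : exists2 c, c \in A & c \notin [set z; b].
    by apply: exists_notin; rewrite cards2 cA; case: eqVneq; lia.
  rewrite !inE negb_or => /andP[cz cb].
  have [eqb|neqb] := eqVneq (swap x b A) (swap y a B); last by exists b.
  exists c; split=> //; apply/eqP=> eqc.
  have := congr1 (fun S : {set T} => c \in S) (etrans eqb (esym eqc)).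
  rewrite !inE cA' cb eqxx orbT orbF => /esym /eqP cx.
  by rewrite -cx cA' in xA.
have cSA : #|swap x b A| = m by rewrite card_swap.
have cSB : #|swap y a B| = m by rewrite card_swap.
have dS : 0 < #|swap x b A :\: swap y a B| <= (m - 3).+2.
  apply/andP; split.
    rewrite card_gt0 setD_eq0; apply: contra neq => sub.
    by rewrite eqEcard sub cSA cSB /=.
  have : 0 < #|swap x b A :&: swap y a B|.
    apply/card_gt0P; exists z; move: zA zB.
    by rewrite !inE (eq_sym z b) (eq_sym z a) bz az /= => -> ->.
  by rewrite cardsD cSA; lia.
have cC : 4 <= #|~: swap x b A| by have := cardsC (swap x b A); lia.
have [s [ss ws ps]] := many_swaps (m - 3) _ _ b a cC (etrans cSA (esym cSB)) dS.
exists (b :: rcons s a); split.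
- by rewrite /= size_rcons ss; lia.
- rewrite rcons_cons; apply: label_walk_swap => //.
  rewrite -!cats1 -catA; apply: label_walk_cat ws _.
  (* The last swap undoes the one that defined [swap y a B]. *)
  apply: label_walk_swap; rewrite ?inE ?eqxx //.
    by rewrite orbF; apply: contraNneq yB => <-.
  by rewrite /= swapK.
- rewrite rcons_path /= ps last_rcons andbT.
  by apply/andP; split; [apply: contraNneq xA => -> | apply: contraNneq yB => <-].
Qed.

End LabelWalks.

(** * From label sequences to walks in the odd graph *)

Section Transfer.
Variable n : nat.
Implicit Types (u v w : odd_vertex n) (e : {set odd_vertex n}).
Implicit Types (x : 'I_(2 * n - 1)) (s : seq 'I_(2 * n - 1)).

Lemma card_vset v : #|vset v| = n - 1.
Proof. exact/eqP/(svalP v). Qed.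

Lemma label_walk_vertices v s w : 0 < n -> label_walk _ (vset v) s (vset w) ->
  exists p, [/\ walk (size s) v w p & all2 (@edge_labeled n) (walk_edges v p) s].
Proof.
move=> n_gt0; elim: s v => [|x s IHs] v /=.
  by move/eqP/val_inj=> ->; exists [::]; rewrite /walk /= !eqxx.
case/andP=> xv.
have cu : #|~: (x |: vset v)| == n - 1.
  by rewrite cardsCs setCK card_ord cardsU1 xv card_vset; lia.
pose u : odd_vertex n := exist (fun A : {set 'I_(2 * n - 1)} => #|A| == n - 1) _ cu.
have adj : odd_adj v u.
  by rewrite /odd_adj disjoints_subset /vset /= setCK subsetUr.
have lab : edge_labeled [set v; u] x.
  rewrite /edge_labeled bigcup_setU !big_set1 {2}/vset /=.
  by apply/eqP/setP=> y; rewrite !inE; case: eqVneq => [->|_]; case: (_ \in vset v) xv.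
case/(IHs u)=> p [/and3P[up sp lp] labs].
exists (u :: p); split; first by rewrite /walk /= adj up /= eqSS sp.
by rewrite /= lab.
Qed.

Lemma edge_labeled_inj e x y : edge_labeled e x -> edge_labeled e y -> x = y.
Proof. by move=> /eqP ex; rewrite /edge_labeled ex => /eqP/set1_inj. Qed.

(** An edge has a single label, so edges with distinct labels are distinct. *)
Lemma sorted_edges (es : seq {set odd_vertex n}) s :
    all2 (@edge_labeled n) es s ->
  sorted (fun x y => x != y) s -> sorted (fun e f => e != f) es.
Proof.
elim: es s => [|e [|f es] IHes] [|x [|y s]] //=; first by rewrite andbF.
move=> /and3P[ex fy all_es] /andP[xy srt].
apply/andP; split; last by apply: (IHes (y :: s)); rewrite /= ?fy.
by apply: contraNneq xy => ef; rewrite ef in ex; rewrite (edge_labeled_inj _ _ _ ex fy).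
Qed.

End Transfer.

Theorem theorem2p1 (n : nat) (n_ge4 : 4 <= n) (w0 w2n : odd_vertex n)
    (l1 l2 : 'I_(2 * n - 1))
    (l1_w0 : l1 \notin vset w0) (l2_w2n : l2 \notin vset w2n) :
  exists p : seq (odd_vertex n),
    [/\ special_walk (2 * n) w0 w2n p,
        edge_labeled (first_edge w0 p) l1 &
        edge_labeled (last_edge w0 p) l2].
Proof.
have cT : #|'I_(2 * n - 1)| = (2 * (n - 1)).+1 by rewrite card_ord; lia.
have m_ge3 : 3 <= n - 1 by lia.
have [s [ss ws ps]] := label_walk_ends _ _ _ _ _ _ m_ge3 cT
  (card_vset _ w0) (card_vset _ w2n) l1_w0 l2_w2n.
have [|p [wp lp]] := label_walk_vertices _ _ _ _ _ ws; first by lia.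
exists p; rewrite /special_walk (sorted_edges _ _ _ lp) // andbT.
have -> : 2 * n = size (l1 :: rcons s l2) by rewrite /= size_rcons ss; lia.
split=> //; rewrite /first_edge /last_edge; move: lp; case: walk_edges => [|e es] //.
  by case/andP.
by move=> lp; have := all2_last _ _ _ _ _ _ _ lp; rewrite /= last_rcons.
Qed.
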